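(* Let $n, d \ge 1$ be integers and let $u_1, \ldots, u_n \in \mathbb{R}^d$ be unit vectors. Then there exists a unit vector $v \in \mathbb{R}^d$ such that \[ \prod_{i=1}^n |\langle u_i, v\rangle| \ge n^{-n/2} . \]
   Context: $\langle\cdot,\cdot\rangle$ is the standard Euclidean inner product on $\mathbb{R}^d$, and a unit vector is a vector of Euclidean norm $1$. The vectors $u_1,\ldots,u_n$ need not be distinct. *)

(* Defs.v *)
From HB Require Import structures.
From mathcomp Require Import all_boot all_order all_algebra.
From mathcomp Require Import reals.
Set Implicit Arguments. Unset Strict Implicit. Unset Printing Implicit Defensive.
Import Order.TTheory GRing.Theory Num.Theory.
Local Open Scope ring_scope.

(* The norm that MathComp-Analysis puts on ['rV[R]_d] is the sup norm, so the
   Euclidean structure is defined here. *)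
Definition dotprod (R : realType) (d : nat) (u v : 'rV[R]_d) : R :=
  \sum_(j < d) u 0 j * v 0 j.

Definition enorm (R : realType) (d : nat) (u : 'rV[R]_d) : R :=
  Num.sqrt (dotprod u u).

(* Main.v *)
Require Import Defs.
From HB Require Import structures.
From mathcomp Require Import all_boot all_order all_algebra.
From mathcomp Require Import reals exp.
From mathcomp Require Import boolp classical_sets functions topology normedtype derive ring lra.
Set Implicit Arguments. Unset Strict Implicit. Unset Printing Implicit Defensive.
Import Order.TTheory GRing.Theory Num.Theory.
Import numFieldNormedType.Exports.
Local Open Scope ring_scope.

(* Let [G] be a positive definite matrix with unit diagonal and consider the
   quadratic system [x_i y_i = 1], [y = x G]. Maximizing [prod_i |x_i|] under
   [x G x^T <= n] in each orthant yields one solution [x_T] for each of the [2^n]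
   sign patterns [T], as many as Bezout's bound allows. For solutions [x], [x'], the
   determinant [B(x, x') = det (diag y + G diag x')] vanishes unless [x = x'], and it
   expands as [sum_S g_S x'^S y^(~S)] over subsets [S]. Hence the [2^n] monomials
   [x^S] and the coefficients [g_S y_T^(~S) / B(x_T, x_T)] form mutually inverse
   matrices; multiplying them in the other order gives an Euler-Jacobi type formula:
   the weights [w_T = prod_i y_(T,i) / B(x_T, x_T)], which are positive, satisfy
   [sum_T w_T x_T^S = 0] for [S] nonempty and [sum_T w_T = 1]. Taking [S = {i, j}]
   in the equation [x_i y_i = 1] gives [sum_T w_T x_(T,i)^2 = 1], so some solution has
   [|x|^2 <= n], hence [prod_i |x_i| <= 1] by AM-GM, i.e. [prod_i |y_i| >= 1].
   Applied to a perturbation of the Gram matrix of the [u_i], with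
   [w = sum_i x_i u_i] one has [y_i ~ <u_i, w>] and [|w|^2 ~ n], so that [w / sqrt n]
   is almost the required vector; compactness of the unit ball concludes. *)

(** * Determinant expansion and the Euler-Jacobi type formula *)

(** Multilinearity in the columns: column [j] is [y_j e_j] plus [x_j] times column [j] of [G], and
    [S] records where the second term is chosen. *)
Lemma det_diag_add_mul_diag (R : comNzRingType) (n : nat) (G : 'M[R]_n)
    (x y : 'rV[R]_n) :
  \det (diag_mx y + G *m diag_mx x) =
  \sum_(S : {set 'I_n}) \det (\matrix_(i, j) (if j \in S then G i j else (i == j)%:R))
     * \prod_i (if i \in S then x 0 i else y 0 i).
Proof.
rewrite -det_tr [LHS]/determinant.
under eq_bigr => s _.
  under eq_bigr => i _.
    rewrite mul_mx_diag !mxE addrC.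
    over.
  rewrite bigA_distr mulr_sumr.
  over.
rewrite exchange_big /=; apply: eq_bigr => S _.
rewrite -[\det _]det_tr /determinant mulr_suml; apply: eq_bigr => s _.
rewrite -mulrA -big_split /=; congr (_ * _); apply: eq_bigr => i _.
rewrite !mxE; case: ifP => // _.
by case: eqP => [-> | _]; rewrite ?mul1r ?mul0r.
Qed.

Section Quadrature.
Variables (F : fieldType) (n : nat) (G : 'M[F]_n) (x : {set 'I_n} -> 'rV[F]_n).
Let y T := x T *m G.
Let J T := \det (diag_mx (y T) + G *m diag_mx (x T)).
Hypothesis x_inj : injective x.
Hypothesis xy1 : forall T i, x T 0 i * y T 0 i = 1.
Hypothesis J_neq0 : forall T, J T != 0.

(* The nonzero row vector [x T - x U] is in the kernel. *)
Lemma bezoutian_eq0 (T U : {set 'I_n}) :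
  T != U -> \det (diag_mx (y T) + G *m diag_mx (x U)) = 0.
Proof.
move=> TU; apply/eqP/det0P; exists (x T - x U).
  by rewrite subr_eq0 (inj_eq x_inj).
rewrite mulmxDr mulmxA (mulmxBl _ _ G) -/(y T) -/(y U); apply/rowP => i.
move: (xy1 T i) (xy1 U i); move: (y T) (y U) => a b aT bU.
by rewrite !mul_mx_diag !mxE !mulrBl aT (mulrC (b 0 i)) bU (mulrC (a 0 i)) subrKA subrr.
Qed.

Lemma quadrature (S : {set 'I_n}) :
  \sum_T (\prod_i y T 0 i) / J T * \prod_(i in S) x T 0 i = (S == finset.set0)%:R.
Proof.
pose N := #|{set 'I_n}|.
pose E (k : 'I_N) : {set 'I_n} := enum_val k.
pose g (S' : {set 'I_n}) := \det (\matrix_(i, j) (if j \in S' then G i j else (i == j)%:R)).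
(* Row [k] of [C] lists the coefficients, in the monomials [x^S], of the determinant with [y] taken
   at solution [k], divided by [J]; [A] evaluates these monomials at the solutions. *)
pose C : 'M[F]_N := \matrix_(k, l)
   (g (E l) * (\prod_(i | i \notin E l) y (E k) 0 i) / J (E k)).
pose A : 'M[F]_N := \matrix_(l, k) \prod_(i in E l) x (E k) 0 i.
have CA : C *m A = 1%:M.
  apply/matrixP => k l; rewrite !mxE.
  have -> : \sum_j C k j * A j l
     = \det (diag_mx (y (E k)) + G *m diag_mx (x (E l))) / J (E k).
    rewrite det_diag_add_mul_diag mulr_suml [RHS](reindex E) /=; last first.
      by apply: onW_bij; apply: enum_val_bij.
    apply: eq_bigr => m _; rewrite !mxE /g -!mulrA; congr (_ * _).
    rewrite big_if /=.
    by ring.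
  have [<-|kl] := eqVneq k l; first by rewrite divff // J_neq0.
  rewrite bezoutian_eq0 ?mul0r //.
  by apply: contra kl => /eqP/enum_val_inj ->.
(* The claim is the column of the empty set in [A *m C = 1%:M]: there [g] is 1 and the complementary
   product runs over all indices. *)
have /matrixP/(_ (enum_rank S) (enum_rank finset.set0)) := mulmx1C CA.
rewrite !mxE (inj_eq enum_rank_inj) => <-.
rewrite (reindex E) /=; last by apply: onW_bij; apply: enum_val_bij.
apply: eq_bigr => k _; rewrite !mxE /E !enum_rankK.
rewrite [LHS]mulrC; congr (_ * _).
have -> : g finset.set0 = 1.
  by rewrite /g -[RHS](det1 F n); congr determinant; apply/matrixP => i j; rewrite !mxE inE.
by rewrite mul1r; congr (_ / _); apply: eq_bigl => i; rewrite inE.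
Qed.

End Quadrature.

(** * Algebra and continuity of the inner product *)

Section DotProduct.
Variables (R : realType) (n : nat).
Implicit Types (u v w : 'rV[R]_n) (G : 'M[R]_n).

Lemma dotprodE u v : dotprod u v = (u *m v^T) 0 0.
Proof. by rewrite mxE; apply: eq_bigr => j _; rewrite mxE. Qed.

Lemma dotprodC u v : dotprod u v = dotprod v u.
Proof. by apply: eq_bigr => j _; rewrite mulrC. Qed.

Lemma dotprodDl u v w : dotprod (u + v) w = dotprod u w + dotprod v w.
Proof. by rewrite !dotprodE mulmxDl mxE. Qed.

Lemma dotprodDr u v w : dotprod u (v + w) = dotprod u v + dotprod u w.
Proof. by rewrite dotprodC dotprodDl !(dotprodC u). Qed.

Lemma dotprodZl a u v : dotprod (a *: u) v = a * dotprod u v.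
Proof. by rewrite !dotprodE -scalemxAl mxE. Qed.

Lemma dotprodZr a u v : dotprod u (a *: v) = a * dotprod u v.
Proof. by rewrite dotprodC dotprodZl dotprodC. Qed.

Lemma dotprod_delta u i : dotprod u (delta_mx 0 i) = u 0 i.
Proof.
rewrite /dotprod (bigD1 i) //= big1 ?addr0 => [|j ji].
  by rewrite mxE !eqxx mulr1.
by rewrite mxE eqxx (negbTE ji) mulr0.
Qed.

Lemma dotprod_mulmx u v G : dotprod (u *m G) v = dotprod u (v *m G^T).
Proof. by rewrite !dotprodE trmx_mul trmxK mulmxA. Qed.

Lemma dotprod_ge0 u : 0 <= dotprod u u.
Proof. by apply: sumr_ge0 => j _; rewrite -expr2 sqr_ge0. Qed.

Lemma sqr_coord_le_dotprod u i : u 0 i ^+ 2 <= dotprod u u.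
Proof.
rewrite /dotprod (bigD1 i) //= -expr2 lerDl.
by apply: sumr_ge0 => j _; rewrite -expr2 sqr_ge0.
Qed.

Lemma dotprod_eq0 u : dotprod u u = 0 -> u = 0.
Proof.
move=> u0; apply/rowP => i; rewrite mxE; apply/eqP.
by rewrite -sqrf_eq0 eq_le sqr_ge0 -u0 sqr_coord_le_dotprod.
Qed.

Lemma dotprod_continuous (f g : 'rV[R]_n -> 'rV[R]_n) :
    (forall j, continuous (fun x => f x 0 j)) ->
    (forall j, continuous (fun x => g x 0 j)) ->
  continuous (fun x => dotprod (f x) (g x)).
Proof.
move=> cf cg; apply: continuous_big => [|j _]; first exact: add_continuous.
by move=> x; exact: (cvgM (cf j x) (cg j x)).
Qed.

Lemma mulmx_coord_continuous m (A : 'M[R]_(n, m)) j :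
  continuous (fun x : 'rV[R]_n => (x *m A) 0 j).
Proof.
rewrite (_ : (fun _ => _) = fun x : 'rV[R]_n => \sum_k x 0 k * A k j).
  apply: continuous_big => [|k _ x]; first exact: add_continuous.
  exact: (cvgM (@coord_continuous R 1 n 0 k x) (cvg_cst _)).
by apply/funext => x; rewrite mxE.
Qed.

End DotProduct.

(** * Maxima on compact sets, critical points, positive determinants *)

Lemma continuous_prod (T : topologicalType) (R : realType) (I : finType) (f : I -> T -> R) :
  (forall i, continuous (f i)) -> continuous (fun x => \prod_i f i x).
Proof. by move=> cf; apply: continuous_big => //; exact: mul_continuous. Qed.

Lemma sublevel_max (R : realType) (n : nat) (q f : 'rV[R]_n -> R) (c K : R) :
    continuous q -> continuous f -> (forall (x : 'rV[R]_n) i, x 0 i ^+ 2 <= K * q x) -> 0 <= K ->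
    (exists x, q x <= c) ->
  exists2 x, q x <= c & forall z, q z <= c -> f z <= f x.
Proof.
move=> cq cf qK K0 [x0 qx0].
pose A := [set x : 'rV[R]_n | q x <= c]%classic.
have cA : compact A.
  (* From [a^2 <= K c] follows [|a| <= K c + 1], because [|a| <= a^2 + 1]. *)
  pose M := K * c + 1.
  have cB := @rV_compact R n (fun=> `[- M, M]%classic) (fun=> @segment_compact R _ _).
  apply: (subclosed_compact _ cB).
    by apply: (@preimage_closed _ _ q [set y | y <= c]%classic) => [x _|]; [exact: cq | exact: closed_le].
  move=> x /= qx i.
  have h : x 0 i ^+ 2 <= K * c by apply: (le_trans (qK x i)); exact: ler_wpM2l.
  by rewrite in_itv /= /M; apply/andP; split; nra.
have [x /set_mem/= qx xmax] := EVT_max_rV (ex_intro _ x0 qx0) cA (continuous_subspaceT cf).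
by exists x => // z qz; apply: xmax; rewrite inE.
Qed.

Lemma deriv_local_min (R : realFieldType) (p : {poly R}) (e : R) : 0 < e ->
  (forall s, `|s| < e -> p.[0] <= p.[s]) -> p^`().[0] = 0.
Proof.
move=> e0 pmin.
have e_itv s : s \in `]- e, e[ -> `|s| < e by rewrite in_itv /= ltr_norml.
have d0 : is_derive (0 : R) 1 (horner p) 0.
  apply: (@derive1_at_min _ _ (- e) e).
  - by lra.
  - by move=> t _; exact: derivable_horner.
  - by rewrite in_itv /= oppr_lt0 e0.
  - by move=> t /e_itv; exact: pmin.
by rewrite -[LHS]derive_val; exact: (@derive_val _ _ _ _ _ _ _ d0).
Qed.

(** The polynomial [det (1 + s N)] is 1 at [s = 0] and has no root [s >= 0], since a kernel vector
    [v] would give [|v|^2 + s v N v^T = 0]. The intermediate value theorem keeps it positive up to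
    [s = 1]. *)
Lemma det1D_gt0 (R : rcfType) (n : nat) (N : 'M[R]_n) :
  (forall v : 'rV[R]_n, 0 <= (v *m N *m v^T) 0 0) -> 0 < \det (1%:M + N).
Proof.
move=> Npsd.
pose P := \det (1%:M + 'X *: map_mx polyC N).
have PE s : P.[s] = \det (1%:M + s *: N).
  rewrite -[LHS]/(horner_eval s P) -det_map_mx; congr determinant.
  apply/matrixP => i j; by rewrite !mxE rmorphD rmorph_nat rmorphM /= /horner_eval hornerX hornerC.
have P_neq0 s : 0 <= s -> P.[s] != 0.
  move=> s0; rewrite PE; apply/det0P => -[v v0 /(congr1 (fun w => (w *m v^T) 0 0))].
  rewrite mulmxDr mulmx1 mulmxDl mul0mx -scalemxAr -scalemxAl [LHS]mxE [X in _ + X = _]mxE [in RHS]mxE.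
  have vv : 0 < (v *m v^T) 0 0.
    rewrite mxE; under eq_bigr do rewrite mxE -expr2.
    rewrite lt0r sumr_ge0 ?andbT => [|i _]; last exact: sqr_ge0.
    rewrite psumr_eq0 => [|i _]; last exact: sqr_ge0.
    apply: contra v0 => /allP v0; apply/eqP/rowP => i; rewrite mxE; apply/eqP.
    by rewrite -sqrf_eq0; apply: v0; rewrite mem_index_enum.
  have := mulr_ge0 s0 (Npsd v); lra.
have P0 : P.[0] = 1 by rewrite PE scale0r addr0 det1.
rewrite -[N]scale1r -PE ltNge; apply/negP => P1.
have [|t t01 /rootP Pt] := @Num.Theory.poly_ivt R (- P) 0 1 ler01.
  by rewrite !hornerN P0 oppr_ge0 P1 oppr_le0 ler01.
by move/eqP: Pt; rewrite hornerN oppr_eq0; apply/negP/P_neq0; case/andP: t01.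
Qed.

(** * Solutions of the quadratic system, one per sign pattern *)

Section Scaling.
Variables (R : realType) (n : nat).
Implicit Types (G : 'M[R]_n) (x v z : 'rV[R]_n).

(** Quantitative positive definiteness, phrased coordinatewise to match the hypothesis of
    [sublevel_max]. *)
Definition coercive (K : R) G :=
  forall v i, v 0 i ^+ 2 <= K * dotprod (v *m G) v.

Lemma positive_scaling G (K : R) : (0 < n)%N -> 0 < K -> G^T = G -> coercive K G ->
  exists2 x : 'rV[R]_n, (forall i, 0 < x 0 i) & forall i, x 0 i * (x *m G) 0 i = 1.
Proof.
move=> n0 K0 Gsym Gco.
pose q v := dotprod (v *m G) v.
(* [f] is a multiple of [\prod_i v 0 i] on the positive orthant and vanishes wherever
   some coordinate is nonpositive, so that no constraint on the signs is needed. *)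
pose f v := \prod_i (v 0 i + `|v 0 i|).
have nR : 0 < n%:R :> R by rewrite ltr0n.
have q_cont : continuous q.
  apply: dotprod_continuous => j; first exact: mulmx_coord_continuous.
  exact: coord_continuous.
have f_cont : continuous f.
  apply: continuous_prod => j x.
  have cx := @coord_continuous R 1 n 0 j x.
  exact: (cvgD cx (cvg_norm cx)).
have qZ a v : q (a *: v) = a ^+ 2 * q v.
  by rewrite /q -scalemxAl dotprodZl dotprodZr mulrA.
have fpos v : (forall i, 0 < v 0 i) -> f v = 2 ^+ n * \prod_i v 0 i.
  move=> v0; rewrite /f -[X in 2 ^+ X](card_ord n) -prodr_const -big_split /=.
  by apply: eq_bigr => i _; rewrite gtr0_norm // mulr2n mulrDl !mul1r.
have qpos v : (forall i, 0 < v 0 i) -> 0 < q v.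
  move=> v0; pose i := Ordinal n0.
  have := Gco v i; rewrite -/(q v); have := v0 i; have : 0 < v 0 i ^+ 2 by exact: exprn_gt0.
  by move=> h _ h'; rewrite -(pmulr_rgt0 _ K0); exact: lt_le_trans h'.
have q0 : q 0 <= n%:R by rewrite /q /dotprod big1 ?ler0n // => i _; rewrite [X in _ * X]mxE mulr0.
have [x qx xmax] := sublevel_max q_cont f_cont Gco (ltW K0) (ex_intro (fun v => is_true (q v <= n%:R)) 0 q0).
(* The maximality of [x], in a form homogeneous in the competitor [z]. *)
have xmaxZ z : (forall i, 0 < z 0 i) -> f z ^+ 2 * n%:R ^+ n <= f x ^+ 2 * q z ^+ n.
  move=> z0; pose a := Num.sqrt (n%:R / q z).
  have a0 : 0 < a by rewrite sqrtr_gt0 divr_gt0 // qpos.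
  have a2 : a ^+ 2 = n%:R / q z by rewrite sqr_sqrtr // divr_ge0 // ltW // qpos.
  have az0 i : 0 < (a *: z) 0 i by rewrite mxE mulr_gt0.
  have fz : 0 <= f z by rewrite fpos // mulr_ge0 ?exprn_ge0 // prodr_ge0 // => i _; rewrite ltW.
  have /xmax : q (a *: z) <= n%:R by rewrite qZ a2 divfK // gt_eqF // qpos.
  have -> : f (a *: z) = a ^+ n * f z.
    rewrite !fpos // mulrCA; congr (_ * _).
    rewrite -[X in a ^+ X](card_ord n) -prodr_const -big_split /=.
    by apply: eq_bigr => i _; rewrite mxE.
  rewrite -(@ler_pXn2r _ 2) ?nnegrE //; last 2 first.
  - by rewrite mulr_ge0 // exprn_ge0 // ltW.
  - by rewrite prodr_ge0 // => i _; rewrite addrC -[X in _ + X]opprK subr_ge0 -normrN ler_norm.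
  rewrite exprMn exprAC a2 expr_div_n mulrAC ler_pdivrMr ?exprn_gt0 ?qpos //.
  by rewrite mulrC.
have fx0 : 0 < f x ^+ 2.
  pose z : 'rV[R]_n := const_mx 1.
  have z0 i : 0 < z 0 i by rewrite mxE.
  have qz : 0 < q z ^+ n by rewrite exprn_gt0 // qpos.
  rewrite -(pmulr_lgt0 _ qz); apply: lt_le_trans (xmaxZ z z0).
  by rewrite mulr_gt0 ?exprn_gt0 // fpos // mulr_gt0 ?exprn_gt0 // prodr_gt0.
have x0 i : 0 < x 0 i.
  rewrite ltNge; apply/negP => xi; move: fx0.
  by rewrite /f (bigD1 i) //= ler0_norm // subrr mul0r expr0n ltxx.
(* The constraint is active: [xmaxZ] at [x] itself gives [n^n <= (q x)^n]. *)
have qxn : q x = n%:R.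
  apply/eqP; rewrite eq_le qx /=.
  by have := xmaxZ x x0; rewrite ler_pM2l // ler_pXn2r // nnegrE ?ltW // qpos.
exists x => // i; set y := (x *m G) 0 i.
have xi_neq0 : x 0 i != 0 by rewrite gt_eqF.
(* Up to the factor [f x ^+ 2], [p.[s]] is the slack in [xmaxZ] at [x + s e_i]. It is minimal at
   [s = 0], and its derivative vanishes there exactly when [y = 1 / x_i]. *)
pose p : {poly R} := (n%:R%:P + (2 * y)%:P * 'X + (G i i)%:P * 'X ^+ 2) ^+ n
  - (n%:R ^+ n)%:P * (1 + (x 0 i)^-1%:P * 'X) ^+ 2.
have pE s : p.[s] = q (x + s *: delta_mx 0 i) ^+ n - n%:R ^+ n * (1 + s / x 0 i) ^+ 2.
  rewrite /p !(hornerE, horner_exp) /=.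
  rewrite [_^-1 * s]mulrC; congr (_ ^+ _ - _).
  rewrite /q mulmxDl dotprodDl !dotprodDr -scalemxAl !dotprodZl !dotprodZr.
  rewrite !dotprod_delta -/y (dotprod_mulmx (delta_mx 0 i)) Gsym [dotprod (delta_mx _ _) _]dotprodC dotprod_delta -/y.
  rewrite -[dotprod _ _]/(q x) qxn.
  have -> : ((delta_mx 0 i : 'rV[R]_n) *m G) 0 i = G i i by rewrite -rowE mxE.
  ring.
have : p^`().[0] = 0.
  apply: (@deriv_local_min _ _ (x 0 i)) => // s sx.
  have -> : p.[0] = 0 by rewrite pE scale0r addr0 qxn mul0r addr0 expr1n mulr1 subrr.
  have s1 : 0 < 1 + s / x 0 i.
    have -> : 1 + s / x 0 i = (x 0 i + s) / x 0 i by field.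
    by rewrite divr_gt0 //; move: sx; rewrite ltr_norml => /andP[]; lra.
  have z0 j : 0 < (x + s *: delta_mx 0 i) 0 j.
    rewrite !mxE eqxx /=; have [->|_] := eqVneq j i; last by rewrite mulr0 addr0.
    by rewrite mulr1; move: sx; rewrite ltr_norml => /andP[]; lra.
  have fz : f (x + s *: delta_mx 0 i) = (1 + s / x 0 i) * f x.
    rewrite !fpos // mulrCA; congr (_ * _).
    rewrite (bigD1 i) //= [in RHS](bigD1 i) //= mulrA; congr (_ * _).
      by rewrite !mxE !eqxx /=; field.
    by apply: eq_bigr => j ji; rewrite !mxE (negbTE ji) andbF mulr0 addr0.
  have := xmaxZ _ z0; rewrite fz exprMn mulrAC mulrC ler_pM2l // pE mulrC.
  by rewrite subr_ge0.
rewrite /p derivB deriv_exp !poly.derivE !(hornerE, horner_exp, hornerMn) /=.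
have -> : n%:R ^+ n = n%:R * n%:R ^+ n.-1 :> R by rewrite -exprS prednK.
rewrite !(mulr0, mul0r, addr0) -mulr_natr => dp0.
have /eqP : (2 * (n%:R * n%:R ^+ n.-1)) * (y - (x 0 i)^-1) = 0.
  by rewrite -[RHS]dp0; ring.
rewrite mulf_eq0 gt_eqF ?mulr_gt0 ?exprn_gt0 //= subr_eq0 => /eqP ->.
by rewrite divff.
Qed.

(** Conjugating [G] by a diagonal matrix of signs preserves symmetry and coercivity, which reduces
    the claim to the positive orthant. *)
Lemma signed_scaling G (K : R) (S : {set 'I_n}) :
    (0 < n)%N -> 0 < K -> G^T = G -> coercive K G ->
  exists2 x : 'rV[R]_n, (forall i, (x 0 i < 0) = (i \in S)) &
    forall i, x 0 i * (x *m G) 0 i = 1.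
Proof.
move=> n0 K0 Gsym Gco.
pose s : 'rV[R]_n := \row_i (if i \in S then -1 else 1).
have ss i : s 0 i * s 0 i = 1 by rewrite mxE; case: ifP; rewrite ?mulrNN mulr1.
pose D := diag_mx s.
have vD (v : 'rV[R]_n) i : (v *m D) 0 i = v 0 i * s 0 i by rewrite mul_mx_diag mxE.
have DT : D^T = D by exact: tr_diag_mx.
have [||v v0 vG] := @positive_scaling (D *m G *m D) K n0 K0.
- by rewrite !trmx_mul DT Gsym mulmxA.
- move=> v i; rewrite mulmxA dotprod_mulmx DT mulmxA.
  by have := Gco (v *m D) i; rewrite vD exprMn [s 0 i ^+ 2]expr2 ss mulr1.
exists (v *m D) => i; first last.
  by rewrite vD -mulrA [s 0 i * _]mulrC -vD -!mulmxA mulmxA -[RHS](vG i) !mulmxA.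
rewrite vD mxE; case: ifP => _; first by rewrite mulrN1 oppr_lt0 v0.
by rewrite mulr1 ltNge ltW.
Qed.

Lemma coercive_ge0 G (K : R) v : 0 < K -> coercive K G -> 0 <= dotprod (v *m G) v.
Proof.
move=> K0 Gco; case: (pickP 'I_n) => [i _|n0]; last by rewrite /dotprod big_pred0.
by rewrite -(pmulr_rge0 _ K0); apply: le_trans (Gco v i); exact: sqr_ge0.
Qed.

(** As [prod_i x_i y_i = 1], the reciprocal of the quotient is [det (diag x (diag y + G diag x)) =
    det (1 + diag x G diag x)], to which [det1D_gt0] applies. *)
Lemma det_scaling_gt0 G (K : R) x : 0 < K -> coercive K G ->
    (forall i, x 0 i * (x *m G) 0 i = 1) ->
  0 < (\prod_i (x *m G) 0 i) / \det (diag_mx (x *m G) + G *m diag_mx x).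
Proof.
move=> K0 Gco xy.
have prod_xy : (\prod_i x 0 i) * (\prod_i (x *m G) 0 i) = 1.
  by rewrite -big_split /= big1.
have px_neq0 : \prod_i x 0 i != 0.
  by apply: contra_eq_neq prod_xy => ->; rewrite mul0r eq_sym oner_eq0.
have -> : \prod_i (x *m G) 0 i = (\prod_i x 0 i)^-1.
  by apply: (mulfI px_neq0); rewrite prod_xy divff.
rewrite -invfM invr_gt0 -det_diag -det_mulmx mulmxDr.
have -> : diag_mx x *m diag_mx (x *m G) = 1%:M.
  by rewrite mul_diag_mx; apply/matrixP => i j; rewrite mxE [in X in _ * X]mxE mulrnAr xy mxE.
apply: det1D_gt0 => v; rewrite !mulmxA -mulmxA -{2}[diag_mx x]tr_diag_mx -trmx_mul -dotprodE.
exact: coercive_ge0 Gco.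
Qed.

Lemma small_scaling G (K : R) : (0 < n)%N -> 0 < K -> G^T = G -> coercive K G ->
    (forall i, G i i = 1) ->
  exists2 x : 'rV[R]_n, (forall i, x 0 i * (x *m G) 0 i = 1) & dotprod x x <= n%:R.
Proof.
move=> n0 K0 Gsym Gco G1.
have sol (S : {set 'I_n}) : exists x : 'rV[R]_n,
    (forall i, (x 0 i < 0) = (i \in S)) /\ (forall i, x 0 i * (x *m G) 0 i = 1).
  by have [x] := signed_scaling S n0 K0 Gsym Gco; exists x.
have [x xP] := choice sol.
have xy S := (xP S).2.
have x_inj : injective x.
  by move=> S T xST; apply/setP => i; rewrite -!(xP _).1 xST.
pose w S := (\prod_i (x S *m G) 0 i) / \det (diag_mx (x S *m G) + G *m diag_mx (x S)).
have w0 S : 0 < w S by exact: det_scaling_gt0 Gco (xy S).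
have J0 S : \det (diag_mx (x S *m G) + G *m diag_mx (x S)) != 0.
  by apply: contraTneq (w0 S) => J0; rewrite /w J0 invr0 mulr0 ltxx.
have quad := quadrature x_inj xy J0.
have w1 : \sum_S w S = 1.
  have q1 := quad finset.set0; rewrite eqxx in q1; refine (etrans _ q1); apply: eq_bigr => S _; by rewrite big_set0 mulr1.
have w_xx i j : i != j -> \sum_S w S * (x S 0 i * x S 0 j) = 0.
  move=> ij; have := quad [set i; j].
  rewrite (_ : _ == _ = false); last by apply/finset.set0Pn; exists i; rewrite !inE eqxx.
  move=> q0; refine (etrans _ q0); apply: eq_bigr => S _.
  by rewrite big_setU1 ?inE //= big_set1.
(* Each weight is multiplied by [x_i y_i = 1] and [y_i] is expanded; the cross terms vanish by
   [w_xx], leaving the square with coefficient [G i i = 1]. *)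
have w_sqr i : \sum_S w S * x S 0 i ^+ 2 = 1.
  rewrite -[RHS]w1.
  under [RHS]eq_bigr => S _.
    rewrite -[w S]mulr1 -(xy S i) [in X in _ * X]mxE (bigD1 i) //= G1 mulr1 mulrDr -expr2 mulrDr.
    rewrite !mulr_sumr.
    over.
  rewrite big_split /= exchange_big /= [X in _ = _ + X]big1 ?addr0 // => j ji.
  transitivity (G j i * \sum_S w S * (x S 0 i * x S 0 j)).
    by rewrite mulr_sumr; apply: eq_bigr => S _; ring.
  by rewrite w_xx 1?eq_sym // mulr0.
(* The excesses [|x_S|^2 - n] average to zero under positive weights, so they cannot all be
   positive. *)
have w_dot : \sum_S w S * (dotprod (x S) (x S) - n%:R) = 0.
  under eq_bigr => S _ do rewrite mulrBr.
  rewrite sumrB -mulr_suml w1 mul1r.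
  under eq_bigr => S _ do rewrite mulr_sumr.
  rewrite exchange_big /=.
  under eq_bigr => i _.
    under eq_bigr do rewrite -expr2.
    rewrite w_sqr.
    over.
  by rewrite sumr_const card_ord subrr.
have [[S xS]|xbig] := pselect (exists S, dotprod (x S) (x S) <= n%:R).
  by exists (x S).
have pos S : 0 < w S * (dotprod (x S) (x S) - n%:R).
  by rewrite mulr_gt0 // subr_gt0 ltNge; apply/negP => xS; apply: xbig; exists S.
suff : 0 < \sum_S w S * (dotprod (x S) (x S) - n%:R) by rewrite w_dot ltxx.
by rewrite (bigD1 finset.set0) //= ltr_pwDl // sumr_ge0 // => S _; exact: ltW.
Qed.

End Scaling.

(** * From the quadratic system to the product bound *)

Lemma bernoulli_inequality (R : realFieldType) (t : R) (n : nat) :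
  0 <= t <= 1 -> 1 - n%:R * t <= (1 - t) ^+ n.
Proof.
move=> /andP[t0 t1]; elim: n => [|n IH]; first by rewrite mul0r subr0 expr0.
rewrite exprSr -natr1.
have n0 : 0 <= n%:R :> R by rewrite ler0n.
have : (1 - n%:R * t) * (1 - t) <= (1 - t) ^+ n * (1 - t) by rewrite ler_wpM2r ?subr_ge0.
by apply: le_trans; nra.
Qed.

Lemma prod_norm_le1 (R : realType) (n : nat) (x : 'rV[R]_n) :
  (0 < n)%N -> dotprod x x <= n%:R -> \prod_i `|x 0 i| <= 1.
Proof.
move=> n0 xn; have nR : 0 < n%:R :> R by rewrite ltr0n.
rewrite -(@ler_pXn2r _ 2) ?nnegrE ?ler01 ?prodr_ge0 // -prodrXl expr1n.
have [le_AGM _] := @leif_AGM R 'I_n predT (fun i => `|x 0 i| ^+ 2) (fun i _ => sqr_ge0 _).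
apply: le_trans le_AGM _; rewrite card_ord exprn_ile1 //.
  by rewrite divr_ge0 // ?ler0n // sumr_ge0 // => i _; exact: sqr_ge0.
rewrite ler_pdivrMr // mul1r; apply: le_trans xn; rewrite /dotprod.
by apply: ler_sum => i _; rewrite -expr2 real_normK ?num_real.
Qed.

Lemma product_lower_bound_approx (R : realType) (n d : nat) (u : 'I_n -> 'rV[R]_d) (t : R) :
    (0 < n)%N -> (forall i, dotprod (u i) (u i) = 1) -> 0 < t -> t * n%:R <= 1 ->
  exists2 z : 'rV[R]_d, dotprod z z <= 1 &
    ((Num.sqrt n%:R)^-1 * (1 - t * n%:R)) ^+ n <= \prod_i `|dotprod (u i) z|.
Proof.
move=> n0 u1 t0 tn; have nR : 1 <= n%:R :> R by rewrite ler1n.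
have t1 : t <= 1 by nra.
pose U : 'M[R]_(n, d) := \matrix_i u i.
(* The Gram matrix may be singular; mixing in [t] times the identity makes it coercive with constant
   [t^-1] and keeps the diagonal equal to 1. *)
pose G : 'M[R]_n := (1 - t) *: (U *m U^T) + t%:M.
have xG (x : 'rV[R]_n) : x *m G = (1 - t) *: (x *m U *m U^T) + t *: x.
  by rewrite mulmxDr -scalemxAr mulmxA mul_mx_scalar.
have UE (w : 'rV[R]_d) i : (w *m U^T) 0 i = dotprod (u i) w.
  by rewrite mxE dotprodC; apply: eq_bigr => j _; rewrite !mxE.
have qG (x : 'rV[R]_n) :
    dotprod (x *m G) x = (1 - t) * dotprod (x *m U) (x *m U) + t * dotprod x x.
  by rewrite xG dotprodDl !dotprodZl [dotprod (_ *m U^T) _]dotprodE -mulmxA -trmx_mul -dotprodE.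
have Gsym : G^T = G by rewrite linearD linearZ /= tr_scalar_mx trmx_mul trmxK.
have G1 i : G i i = 1.
  rewrite !mxE eqxx mulr1n.
  have -> : \sum_j U i j * U^T j i = dotprod (u i) (u i).
    by apply: eq_bigr => j _; rewrite !mxE.
  by rewrite u1 mulr1 subrK.
have Gco : coercive t^-1 G.
  move=> x i; rewrite -(ler_pM2l t0) mulVKf ?gt_eqF // qG.
  have := sqr_coord_le_dotprod x i; have := dotprod_ge0 (x *m U); nra.
have [|x xy xn] := small_scaling n0 _ Gsym Gco G1; first by rewrite invr_gt0.
pose w := x *m U.
have sn0 : 0 < Num.sqrt n%:R :> R by rewrite sqrtr_gt0; lra.
have sn2 : Num.sqrt n%:R ^+ 2 = n%:R :> R by rewrite sqr_sqrtr //; lra.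
have ww : (1 - t) * dotprod w w <= n%:R.
  have : dotprod (x *m G) x = n%:R.
    by rewrite /dotprod (eq_bigr (fun=> 1)) ?sumr_const ?card_ord // => i _; rewrite mulrC.
  by rewrite qG -/w => <-; rewrite lerDl mulr_ge0 ?dotprod_ge0 // ltW.
(* The factor [1 - t] gives [<u_i, (1 - t) w> = y_i - t x_i], and the squared norm is at most
   [1 - t]. *)
exists ((Num.sqrt n%:R)^-1 *: ((1 - t) *: w)).
  have -> : dotprod ((Num.sqrt n%:R)^-1 *: ((1 - t) *: w)) ((Num.sqrt n%:R)^-1 *: ((1 - t) *: w))
      = (1 - t) * ((1 - t) * dotprod w w) / n%:R.
    by rewrite !(dotprodZl, dotprodZr) -[X in _ / X]sn2; field; rewrite gt_eqF.
  rewrite ler_pdivrMr ?mul1r; last lra.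
  by have := dotprod_ge0 w; nra.
have xw i : x 0 i * ((1 - t) * dotprod (u i) w) = 1 - t * x 0 i ^+ 2.
  have : x 0 i * ((1 - t) * dotprod (u i) w + t * x 0 i) = 1.
    by rewrite -[RHS](xy i) xG -UE !mxE.
  by lra.
have xw_ge i : 1 - t * n%:R <= `|x 0 i| * `|(1 - t) * dotprod (u i) w|.
  rewrite -normrM xw; apply: le_trans (ler_norm _).
  by rewrite lerD2l lerN2 ler_wpM2l ?(ltW t0) // (le_trans (sqr_coord_le_dotprod x i)).
under eq_bigr do rewrite 2!dotprodZr normrM gtr0_norm ?invr_gt0 //.
rewrite exprMn big_split /= prodr_const card_ord ler_pM2l ?exprn_gt0 ?invr_gt0 //.
rewrite -[X in _ ^+ X](card_ord n) -prodr_const.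
(* Inserting [prod_i |x_i| <= 1] only lowers the product, and each paired factor is bounded below by
   [xw_ge]. *)
apply: (@le_trans _ _ (\prod_i (`|x 0 i| * `|(1 - t) * dotprod (u i) w|))).
  by apply: ler_prod => i _; rewrite xw_ge subr_ge0 tn.
by rewrite big_split /= ler_piMl ?prodr_ge0 // prod_norm_le1.
Qed.

Theorem theorem2 (R : realType) (n d : nat) (hn : (1 <= n)%N) (hd : (1 <= d)%N)
    (u : 'I_n -> 'rV[R]_d) (hu : forall i : 'I_n, enorm (u i) = 1) :
  exists v : 'rV[R]_d,
    enorm v = 1 /\
    n%:R `^ (- (n%:R / 2%:R)) <= \prod_(i < n) `|dotprod (u i) v|.
Proof.
have u1 i : dotprod (u i) (u i) = 1.
  by rewrite -[LHS]sqr_sqrtr ?dotprod_ge0 // -/(enorm _) hu expr1n.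
have nR : 1 <= n%:R :> R by rewrite ler1n.
pose f (v : 'rV[R]_d) := \prod_(i < n) `|dotprod (u i) v|.
pose b : R := (Num.sqrt n%:R)^-1 ^+ n.
have b0 : 0 < b by rewrite exprn_gt0 // invr_gt0 sqrtr_gt0; lra.
have powE : n%:R `^ (- (n%:R / 2%:R)) = b.
  rewrite powRN mulrC powRrM powR12_sqrt ?ler0n // powR_mulrn ?sqrtr_ge0 //.
  by rewrite /b exprVn.
have q_cont : continuous (fun v : 'rV[R]_d => dotprod v v).
  by apply: dotprod_continuous => j; exact: coord_continuous.
have f_cont : continuous f.
  apply: continuous_prod => i v.
  have cu : continuous (fun w : 'rV[R]_d => dotprod (u i) w).
    apply: (dotprod_continuous (f := fun=> u i) (g := id)) => j; last exact: coord_continuous.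
    exact: cst_continuous.
  exact: (cvg_norm (cu v)).
have q_co (v : 'rV[R]_d) i : v 0 i ^+ 2 <= 1 * dotprod v v.
  by rewrite mul1r sqr_coord_le_dotprod.
have q0 : dotprod (0 : 'rV[R]_d) 0 <= 1.
  by rewrite /dotprod big1 ?ler01 // => j _; rewrite mxE mul0r.
have [v v1 vmax] := sublevel_max q_cont f_cont q_co ler01
  (ex_intro (fun v => is_true (dotprod v v <= 1)) 0 q0).
have fv : b <= f v.
  rewrite leNgt; apply/negP => fvb.
  have r0 : 0 <= f v / b by rewrite divr_ge0 ?(ltW b0) // prodr_ge0.
  have r1 : f v / b < 1 by rewrite ltr_pdivrMr // mul1r.
  (* With this [t], Bernoulli's bound [1 - t n^2] is the midpoint of [f v / b] and 1, hence exceeds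
     [f v / b], contradicting the maximality of [v]. *)
  pose t := (1 - f v / b) / (2 * n%:R ^+ 2).
  have tE : t * n%:R ^+ 2 = (1 - f v / b) / 2 by rewrite /t; field; lra.
  have t0 : 0 < t by rewrite divr_gt0 ?mulr_gt0 ?exprn_gt0; lra. clearbody t.
  have tn : t * n%:R <= 1.
    have : 0 <= t * n%:R * (n%:R - 1) by rewrite !mulr_ge0 ?subr_ge0 ?(ltW t0) ?ler0n.
    by rewrite expr2 in tE; lra.
  have [z z1] := product_lower_bound_approx hn u1 t0 tn.
  move=> /le_trans/(_ (vmax z z1)); rewrite exprMn -/b -ler_pdivlMl // [b^-1 * _]mulrC.
  have /bernoulli_inequality-/(_ n) : 0 <= t * n%:R <= 1 by rewrite tn mulr_ge0 ?ler0n // ltW.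
  have -> : n%:R * (t * n%:R) = t * n%:R ^+ 2 by ring.
  by rewrite tE; lra.
have v0 : 0 < dotprod v v.
  rewrite lt0r dotprod_ge0 andbT; apply: contraTneq (lt_le_trans b0 fv) => /dotprod_eq0 ->.
  rewrite /f (bigD1 (Ordinal hn)) //= /dotprod big1 ?normr0 ?mul0r ?ltxx // => j _.
  by rewrite mxE mulr0.
have nv0 : 0 < enorm v by rewrite sqrtr_gt0.
have nv2 : enorm v ^+ 2 = dotprod v v by rewrite sqr_sqrtr // ltW.
exists ((enorm v)^-1 *: v); split.
  rewrite -[RHS]sqrtr1; congr Num.sqrt.
  by rewrite dotprodZl dotprodZr -nv2 expr2 mulKf ?gt_eqF // mulVf ?gt_eqF.
(* Since [enorm v <= 1], normalizing [v] can only increase each factor. *)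
rewrite powE; apply: le_trans fv _; apply: ler_prod => i _.
rewrite normr_ge0 dotprodZr normrM gtr0_norm ?invr_gt0 // ler_peMl // invf_ge1 //.
by rewrite -(@ler_pXn2r _ 2) ?nnegrE ?ler01 ?(ltW nv0) // expr1n nv2.
Qed.
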